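(* Let $\mathbf{A}=[w_{ij}]_{i,j=1}^n\in\mathbb{R}^{n\times n}$ be the adjacency matrix of a (directed or undirected) weighted graph $\mathcal{G}$ with $n$ vertices, so that $w_{ij}\ge 0$ for all $1\le i,j\le n$ and $w_{ii}=0$ for all $i$. Let $e=[1,1,\ldots,1]^T\in\mathbb{R}^n$ and $\exp_0(t)=\exp(t)-1$. Then all entries of the gradient $\nabla T_{\mathcal{G}}(w_{11},w_{21},\ldots,w_{nn})$ of the total communicability are nonnegative, i.e., $$\frac{\partial}{\partial w_{ij}}\, e^T\exp_0(\mathbf{A})\,e\;\ge\;0\qquad\text{for all } 1\le i,j\le n.$$
   Context: For a square matrix $\mathbf{A}$, $\exp_0(\mathbf{A})=\exp(\mathbf{A})-\mathbf{I}=\mathbf{A}+\frac{\mathbf{A}^2}{2!}+\frac{\mathbf{A}^3}{3!}+\cdots$. The graph has vertices $v_1,\dots,v_n$, no multiple edges and no self-loops; the weight $w_{ij}$ is positive if there is an edge from $v_i$ to $v_j$ and is zero otherwise. The total communicability of $\mathcal{G}$ is $T_{\mathcal{G}}(w_{11},w_{21},\ldots,w_{nn})=e^T\exp_0(\mathbf{A})e$, regarded as a function of the $n^2$ matrix entries $w_{ij}$, which are treated as independent real variables (also when $\mathbf{A}$ is symmetric, and also for entries that are zero). Its gradient $\nabla T_{\mathcal{G}}$ is the vector of the $n^2$ partial derivatives $\frac{\partial}{\partial w_{ij}}e^T\exp_0(\mathbf{A})e$, evaluated at the given adjacency matrix. Equivalently, $\frac{\partial}{\partial w_{ij}}e^T\exp_0(\mathbf{A})e$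 is the derivative at $h=0$ of $h\mapsto e^T\exp_0(\mathbf{A}+h e_ie_j^T)e$, where $e_k$ is the $k$th column of the identity matrix. *)

(* Defs.v *)
From HB Require Import structures.
From mathcomp Require Import all_boot all_order all_algebra.
From mathcomp Require Import all_classical all_reals all_analysis.

Set Implicit Arguments.
Unset Strict Implicit.
Unset Printing Implicit Defensive.

Import Order.TTheory GRing.Theory Num.Theory.
Import numFieldNormedType.Exports.

Local Open Scope classical_set_scope.
Local Open Scope ring_scope.

(* An undirected graph is one in which [edge] and [weight] are symmetric. *)
Record wgraph (R : realType) (n : nat) := WGraph {
  edge : rel 'I_n;
  weight : 'I_n -> 'I_n -> R;
  edge_irr : irreflexive edge;
  weight_gt0 : forall i j, edge i j -> 0 < weight i j;
  weight_eq0 : forall i j, ~~ edge i j -> weight i j = 0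
}.

Definition adjmx (R : realType) (n : nat) (G : wgraph R n) : 'M[R]_n :=
  \matrix_(i, j) weight G i j.

(* The limit is taken in the normed space of matrices (entrywise max norm);
   the sequence of partial sums converges for every [A]. *)
Definition expmx (R : realType) (n : nat) (A : 'M[R]_n) : 'M[R]_n :=
  limn (series (fun k : nat => (k`!%:R)^-1 *: (A ^+ k))).

Definition expmx0 (R : realType) (n : nat) (A : 'M[R]_n) : 'M[R]_n :=
  expmx A - 1%:M.

Definition ones (R : realType) (n : nat) : 'cV[R]_n := const_mx 1.

(* Defined on all real matrices, so that the n^2 entries are independent
   variables when partial derivatives are taken. *)
Definition total_communicability (R : realType) (n : nat) (A : 'M[R]_n) : R :=
  ((ones R n)^T *m expmx0 A *m ones R n) ord0 ord0.

(* Entry (i, j) is the partial derivative in the (i, j) variable, i.e. the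
   derivative along the elementary matrix e_i e_j^T; it is only meaningful
   when [derivable f A (delta_mx i j)], since ['D] is total. *)
Definition gradient (R : realType) (n : nat) (f : 'M[R]_n -> R) (A : 'M[R]_n) :
    'M[R]_n :=
  \matrix_(i, j) ('D_(delta_mx i j) f A : R).

(* Main.v *)
(* With D_0 = 0 and D_(k+1) = A D_k + V A^k (the coefficient of h in
   (A + h V)^k), an induction gives
     |(A + h V)^k - A^k - h D_k| <= h^2 (3 M)^k   for |h| <= 1,
   with M = n (|A| + |V|) and |.| the max norm. Dividing by k! and summing
   shows that exp is differentiable at A in the direction V, with derivative
   the sum of the D_k / k!, which is entrywise nonnegative when A and V are. *)
Require Import Defs.
From HB Require Import structures.
From mathcomp Require Import all_boot all_order all_algebra.
From mathcomp Require Import all_classical all_reals all_analysis.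
From mathcomp Require Import ring.

Set Implicit Arguments.
Unset Strict Implicit.
Unset Printing Implicit Defensive.

Import Order.TTheory GRing.Theory Num.Theory.
Import numFieldNormedType.Exports.

Local Open Scope classical_set_scope.
Local Open Scope ring_scope.

(* Provides the join [completeNormedModType] on matrices, which the library
   lacks although it has completeness and the norm separately. *)
HB.instance Definition _ (R : realType) (m n : nat) :=
  Uniform_isComplete.Build 'M[R]_(m, n) cauchy_cvg.

(** * Series dominated by a multiple of the real exponential series *)

Section DominatedSeries.
Variables (R : realType) (V : completeNormedModType R) (u : V ^nat) (c x : R).
Hypothesis u_le : forall k, `|u k| <= c * exp_coeff x k.

Let cvg_dom : cvgn (series (c *: exp_coeff x)).
Proof. by apply: is_cvg_seriesZ; exact: is_cvg_series_exp_coeff. Qed.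

Lemma exp_dominated_normed_cvg : cvgn [normed series u].
Proof.
apply: series_le_cvg cvg_dom => // k.
  exact: normr_ge0.
by apply: le_trans (u_le k).
Qed.

Lemma exp_dominated_cvg : cvgn (series u).
Proof. exact: normed_cvg exp_dominated_normed_cvg. Qed.

Lemma exp_dominated_norm_lim : `|limn (series u)| <= c * expR x.
Proof.
apply: le_trans (lim_series_norm exp_dominated_normed_cvg) _.
have := lim_series_le exp_dominated_normed_cvg cvg_dom u_le.
by rewrite lim_seriesZ //; exact: is_cvg_series_exp_coeff.
Qed.

End DominatedSeries.

(** * The max norm and matrix products *)

Lemma coord_le_mx_norm (R : realType) (m n : nat) (A : 'M[R]_(m, n)) i j :
  `|A i j| <= `|A|.
Proof.
by rewrite [leRHS]/Num.Def.normr /= mx_normrE; exact: (le_bigmax _ _ (i, j)).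
Qed.

Lemma mx_norm_leP (R : realType) (m n : nat) (A : 'M[R]_(m, n)) (c : R) :
  0 <= c -> (forall i j, `|A i j| <= c) -> `|A| <= c.
Proof.
move=> c_ge0 Ac; rewrite [leLHS]/Num.Def.normr /= mx_normrE.
by apply: bigmax_le => // -[i j] _; exact: Ac.
Qed.

(** Each entry of the product is a sum of [n] terms of size at most [|A| * |B|]. The factor [n] is
    later absorbed into [M]. *)
Lemma mx_norm_mulmx (R : realType) (m n p : nat)
    (A : 'M[R]_(m, n)) (B : 'M[R]_(n, p)) :
  `|A *m B| <= n%:R * `|A| * `|B|.
Proof.
apply: mx_norm_leP => [|i j]; first by rewrite !mulr_ge0.
rewrite mxE (le_trans (ler_norm_sum _ _ _))//.
rewrite -mulrA mulr_natl -[X in _ *+ X]card_ord -sumr_const ler_sum // => k _.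
by rewrite normrM ler_pM // coord_le_mx_norm.
Qed.

(* The derivative at [A] of the [k]-th power in the direction [V]. *)
Fixpoint dpowmx (R : realType) (n : nat) (A V : 'M[R]_n) (k : nat) : 'M[R]_n :=
  if k is k'.+1 then A *m dpowmx A V k' + V *m A ^+ k' else 0.

Definition dexpmx (R : realType) (n : nat) (A V : 'M[R]_n) : 'M[R]_n :=
  limn (series (fun k => (k`!%:R)^-1 *: dpowmx A V k)).

(** * The matrix exponential and its directional derivative *)

Section MatrixExponential.
Variables (R : realType) (n : nat).
Implicit Types (A V X : 'M[R]_n) (M h c : R).

Lemma mx_norm_mulmx_le A X M : n%:R * `|A| <= M -> `|A *m X| <= M * `|X|.
Proof.
by move=> AM; rewrite (le_trans (mx_norm_mulmx _ _))// ler_wpM2r.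
Qed.

Lemma mx_norm_exp A M k : n%:R * `|A| <= M -> `|A ^+ k| <= M ^+ k.
Proof.
move=> AM; have M_ge0 : 0 <= M by rewrite (le_trans _ AM)// mulr_ge0.
elim: k => [|k IHk].
  rewrite !expr0; apply: mx_norm_leP => // i j.
  by rewrite mxE; case: eqP; rewrite ?normr1 ?normr0.
by rewrite !exprS (le_trans (mx_norm_mulmx_le _ AM))// ler_wpM2l.
Qed.

Section Expansion.
Variables (A V : 'M[R]_n) (M : R).
Hypotheses (AM : n%:R * `|A| <= M) (VM : n%:R * `|V| <= M).

Let M_ge0 : 0 <= M.
Proof. by rewrite (le_trans _ AM)// mulr_ge0. Qed.

(** Each of the two terms of the recursion is at most [M * (2 * M) ^+ k]; the base 2 makes room for
    both. *)
Lemma mx_norm_dpowmx k : `|dpowmx A V k| <= (2 * M) ^+ k.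
Proof.
elim: k => [|k IHk] /=; first by rewrite normr0.
rewrite exprS -mulrA mulr_natl mulr2n.
rewrite (le_trans (ler_normD _ _))// lerD //.
  by rewrite (le_trans (mx_norm_mulmx_le _ AM))// ler_wpM2l.
rewrite (le_trans (mx_norm_mulmx_le _ VM))// ler_wpM2l //.
rewrite (le_trans (mx_norm_exp _ AM))// lerXn2r ?nnegrE ?mulr_ge0 //.
by rewrite ler_peMl // ler1n.
Qed.

Lemma mx_norm_expD_remainder h k : n%:R * `|A + h *: V| <= M ->
  `|(A + h *: V) ^+ k - A ^+ k - h *: dpowmx A V k| <= h ^+ 2 * (3 * M) ^+ k.
Proof.
move=> AhVM; elim: k => [|k IHk] /=.
  by rewrite !expr0 subrr scaler0 subr0 normr0 mulr1 sqr_ge0.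
set E := (X in `|X| <= _) in IHk.
(* The error obeys E_(k+1) = (A + h V) E_k + h^2 V D_k: the terms of order 0 and 1 in h cancel. *)
have -> : (A + h *: V) ^+ k.+1 - A ^+ k.+1 -
    h *: (A *m dpowmx A V k + V *m A ^+ k) =
  (A + h *: V) *m E + h ^+ 2 *: (V *m dpowmx A V k).
  have -> : (A + h *: V) ^+ k.+1 =
      (A + h *: V) *m (E + A ^+ k + h *: dpowmx A V k).
    by rewrite exprS addrAC /E !subrK.
  rewrite exprS -[A * _]/(A *m _) !mulmxDr !mulmxDl -!scalemxAl -!scalemxAr.
  (* With the products generalized, the identity is linear in them and can be checked entrywise by
     [ring]. *)
  move: (A *m E) (V *m E) (A *m A ^+ k) (V *m A ^+ k) (A *m dpowmx A V k)
    (V *m dpowmx A V k) => AE VE AA VA AD VD.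
  by apply/matrixP => i j; rewrite !mxE; ring.
(* The factor 3 splits as 1 + 2: one share for the propagated error, two for the new term, which
   needs only one of them. *)
have -> : h ^+ 2 * (3 * M) ^+ k.+1 =
    M * (h ^+ 2 * (3 * M) ^+ k) + h ^+ 2 * (M * (2 * (3 * M) ^+ k)).
  by rewrite [(3 * M) ^+ _]exprS; ring.
rewrite (le_trans (ler_normD _ _))// normrZ normrX real_normK ?num_real //.
rewrite lerD //.
  by rewrite (le_trans (mx_norm_mulmx_le _ AhVM))// ler_wpM2l.
rewrite ler_wpM2l ?sqr_ge0 // (le_trans (mx_norm_mulmx_le _ VM))// ler_wpM2l //.
rewrite (le_trans (mx_norm_dpowmx k))//.
have M3_ge0 : 0 <= 3 * M by rewrite mulr_ge0.
have -> : 2 * (3 * M) ^+ k = (3 * M) ^+ k + (3 * M) ^+ k by ring.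
rewrite ler_wpDr ?exprn_ge0 // lerXn2r ?nnegrE ?mulr_ge0 //.
by rewrite ler_wpM2r // ler_nat.
Qed.

End Expansion.

(** Since [exp_coeff M k] is M^k / k!, geometric bounds on the matrices turn into the domination
    hypothesis for their exponential series. *)
Lemma exp_term_le k X c M : `|X| <= c * M ^+ k ->
  `|(k`!%:R)^-1 *: X| <= c * exp_coeff M k.
Proof.
move=> XM; rewrite normrZ ger0_norm ?invr_ge0 //.
by rewrite /exp_coeff /= mulrA mulrC ler_wpM2r ?invr_ge0.
Qed.

Lemma expmx_cvg A : cvgn (series (fun k => (k`!%:R)^-1 *: A ^+ k)).
Proof.
apply: (@exp_dominated_cvg _ _ _ 1 (n%:R * `|A|)) => //.
by move=> k; apply: exp_term_le; rewrite mul1r mx_norm_exp.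
Qed.

Lemma dexpmx_cvg A V : cvgn (series (fun k => (k`!%:R)^-1 *: dpowmx A V k)).
Proof.
pose M := n%:R * (`|A| + `|V|).
have M_ge0 : 0 <= M by rewrite mulr_ge0 ?addr_ge0.
apply: (@exp_dominated_cvg _ _ _ 1 (2 * M)) => //.
move=> k; apply: exp_term_le; rewrite mul1r mx_norm_dpowmx //.
- by rewrite ler_wpM2l // lerDl.
- by rewrite ler_wpM2l // lerDr.
Qed.

Lemma mx_norm_expmxD_remainder A V h : `|h| <= 1 ->
  `|expmx (A + h *: V) - expmx A - h *: dexpmx A V|
    <= h ^+ 2 * expR (3 * (n%:R * (`|A| + `|V|))).
Proof.
move=> h_le1; set M := n%:R * _.
have M_ge0 : 0 <= M by rewrite mulr_ge0 ?addr_ge0.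
have AM : n%:R * `|A| <= M by rewrite ler_wpM2l // lerDl.
have VM : n%:R * `|V| <= M by rewrite ler_wpM2l // lerDr.
(* Here [|h| <= 1] is used, so that [M] does not depend on [h]. *)
have AhVM : n%:R * `|A + h *: V| <= M.
  rewrite ler_wpM2l // (le_trans (ler_normD _ _))// lerD2l normrZ.
  by rewrite ler_piMl.
(* The three convergent series are merged into one, so that the bound applies term by term. *)
pose E k := (k`!%:R)^-1 *: ((A + h *: V) ^+ k - A ^+ k - h *: dpowmx A V k).
have -> : expmx (A + h *: V) - expmx A - h *: dexpmx A V = limn (series E).
  apply/esym/cvg_lim => //.
  have -> : series E = series (fun k => (k`!%:R)^-1 *: (A + h *: V) ^+ k) -
    series (fun k => (k`!%:R)^-1 *: A ^+ k) -
    h *: series (fun k => (k`!%:R)^-1 *: dpowmx A V k).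
    apply/funext => N; rewrite !fctE /series /= scaler_sumr -!sumrB.
    apply: eq_bigr => k _; rewrite /E !scalerBr; congr (_ - _).
    by rewrite !scalerA mulrC.
  apply: cvgB; first by apply: cvgB; exact: expmx_cvg.
  by apply: cvgZr; exact: dexpmx_cvg.
apply: exp_dominated_norm_lim; rewrite ?sqr_ge0 ?mulr_ge0 // => k.
by apply: exp_term_le; exact: mx_norm_expD_remainder.
Qed.

Lemma is_derive_expmx A V : is_derive A V (@expmx R n) (dexpmx A V).
Proof.
set C := expR (3 * (n%:R * (`|A| + `|V|))).
have C_gt0 : 0 < C by exact: expR_gt0.
suff dexp : h^-1 *: ((@expmx R n \o shift A) (h *: V) - expmx A) @[h --> 0^']
    --> dexpmx A V.
  by apply: DeriveDef; [exact: cvgP dexp | exact: cvg_lim dexp].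
apply/cvgrPdist_le => e e_gt0; near=> h.
have h_neq0 : h != 0 by near: h; exact: nbhs_dnbhs_neq.
have h_le1 : `|h| <= 1 by near: h; exact: dnbhs0_le.
rewrite /= [h *: V + A]addrC distrC.
set F := expmx _ - expmx A.
have -> : h^-1 *: F - dexpmx A V = h^-1 *: (F - h *: dexpmx A V).
  by rewrite [RHS]scalerBr scalerA mulVf // scale1r.
rewrite normrZ normfV ler_pdivrMl ?normr_gt0 //.
apply: le_trans (mx_norm_expmxD_remainder _ _ h_le1) _.
(* One factor [|h|] of h^2 cancels, which leaves [|h| <= e / C], true for [h] near 0. *)
rewrite -/C -real_normK ?num_real // expr2 -mulrA ler_wpM2l // -ler_pdivlMr //.
by near: h; apply: dnbhs0_le; rewrite divr_gt0.
Unshelve. all: by end_near. Qed.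

Lemma dpowmx_ge0 A V k : (forall i j, 0 <= A i j) -> (forall i j, 0 <= V i j) ->
  forall i j, 0 <= dpowmx A V k i j.
Proof.
move=> A_ge0 V_ge0.
have mulmx_ge0 (X Y : 'M[R]_n) : (forall i j, 0 <= X i j) ->
    (forall i j, 0 <= Y i j) -> forall i j, 0 <= (X *m Y) i j.
  by move=> X_ge0 Y_ge0 i j; rewrite mxE sumr_ge0 // => l _; rewrite mulr_ge0.
have exp_ge0 l : forall i j, 0 <= (A ^+ l) i j.
  elim: l => [|l IHl] i j; first by rewrite expr0 mxE ler0n.
  by rewrite exprS mulmx_ge0.
elim: k => [|k IHk] i j /=; first by rewrite mxE.
by rewrite mxE addr_ge0 ?mulmx_ge0.
Qed.

(** Entries depend continuously on the matrix, so each entry of the sum is the limit of the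
    nonnegative entries of the partial sums. *)
Lemma dexpmx_ge0 A V : (forall i j, 0 <= A i j) -> (forall i j, 0 <= V i j) ->
  forall i j, 0 <= dexpmx A V i j.
Proof.
move=> A_ge0 V_ge0 i j.
have dcvg := cvg_comp _ _ (@dexpmx_cvg A V) (@coord_continuous R n n i j _).
rewrite -(cvg_lim _ dcvg) //; apply: limr_ge; first exact: cvgP dcvg.
near=> N; rewrite /series /= summxE sumr_ge0 // => k _.
by rewrite mxE mulr_ge0 ?invr_ge0 ?dpowmx_ge0.
Unshelve. all: by end_near. Qed.

End MatrixExponential.

(** * The gradient of the total communicability *)

Lemma total_communicabilityE (R : realType) (n : nat) (A : 'M[R]_n) :
  total_communicability A = \sum_i \sum_j (expmx A i j - (i == j)%:R).
Proof.
rewrite /total_communicability mxE exchange_big /=; apply: eq_bigr => j _.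
rewrite [ones _ _ _ _]mxE mulr1 mxE; apply: eq_bigr => i _.
by rewrite !mxE mul1r.
Qed.

Lemma is_derive_total_communicability (R : realType) (n : nat)
    (A V : 'M[R]_n) :
  is_derive A V (@total_communicability R n) (\sum_i \sum_j dexpmx A V i j).
Proof.
(* As a sum of functions it can be differentiated termwise; the identity matrix contributes only
   constants. *)
have -> : @total_communicability R n =
    \sum_i \sum_j ((fun X => expmx X i j) - cst (i == j)%:R).
  apply/funext => X; rewrite total_communicabilityE fct_sumE.
  by apply: eq_bigr => i _; rewrite fct_sumE.
have [dA dAE] := is_derive_expmx A V.
apply: is_derive_sum => i; apply: is_derive_sum => j.
rewrite -[dexpmx A V i j]subr0; apply: is_deriveB.
apply: DeriveDef; first exact: (derivable_mxP _ _ _).1.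
by rewrite -dAE derive_mx // mxE.
Qed.

Theorem theorem2 (R : realType) (n : nat) (G : wgraph R n) (i j : 'I_n) :
  derivable (@total_communicability R n) (adjmx G) (delta_mx i j) /\
  0 <= gradient (@total_communicability R n) (adjmx G) i j.
Proof.
have [dT dTE] := is_derive_total_communicability (adjmx G) (delta_mx i j).
split=> //; rewrite mxE dTE sumr_ge0 // => k _; rewrite sumr_ge0 // => l _.
(* The direction [delta_mx i j] has entries 0 and 1; the weights are positive on edges and zero
   elsewhere. *)
apply: dexpmx_ge0 => a b; rewrite mxE; last exact: ler0n.
have [/weight_gt0/ltW //|/weight_eq0 ->//] := boolP (edge G a b).
Qed.
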